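(* Let $N\ge1$ and $M\ge 2$ be integers. (i) If a set of $R$ configurations of an $M$-mode linear optical interferometer followed by photon counting allows reconstruction of every $N$-photon, $M$-mode state, then $$R\ge R_{N,M}:=\binom{N+M}{N}-\binom{N+M-2}{M}.$$ (ii) More generally, for an interferometer with $M'>M\ge 2$ modes, where the $N$-photon $M$-mode state is supplemented by $M'-M$ ancillary modes in the vacuum state, any set of $R$ configurations allowing reconstruction of every $N$-photon, $M$-mode state satisfies $$R\ge R_{N,M,M'}:=\left\lceil \frac{(N+M-2)!\,(M'-2)!}{(N+M'-2)!\,(M-2)!}\,R_{N,M}\right\rceil.$$
   Context: Let $a_1,\dots,a_{M'}$ be bosonic annihilation operators of $M'\ge M$ optical modes. An $N$-photon, $M$-mode state is a density operator $\rho$ on the span of Fock states $|k_1,\dots,k_M\rangle$ with $\sum_j k_j=N$. When $M'>M$ the input to the interferometer is $\rho\otimes|0\rangle\langle0|$ with the last $M'-M$ modes in vacuum. A configuration of an $M'$-mode linear optical interferometer is a unitary $g=e^{iH}\in\mathrm U(M')$ acting on Fock space as $U(g)=\exp\!\big(i\sum_{k,l}H_{kl}a_k^\dagger a_l\big)$. Photon counting on all $M'$ output modes after configuration $g$ gives outcome $\nu'$ (an $M'$-mode Fock state with $N$ photons) with probability $p_{\nu',g}=\langle\nu'|U(g)^\dagger(\rho\otimes|0\rangle\langle 0|)U(g)|\nu'\rangle$. A set of configurations $g_1,\dots,g_R$ allows reconstruction if the probabilities $(p_{\nu',g_j})_{\nu',j}$ determine $\rho$ uniquely (the map $\rho\mapsto(p_{\nu',g_j})$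 is injective). $\lceil x\rceil$ denotes the smallest integer greater than or equal to $x$. *)

(* Defs.v *)
(* mathcomp + mathcomp-reals (realType) + real-closed (complex R = R[i]). *)
From HB Require Import structures.
From mathcomp Require Import all_boot all_order all_algebra all_fingroup.
From mathcomp Require Import reals.
From mathcomp Require Import complex.

Set Implicit Arguments. Unset Strict Implicit. Unset Printing Implicit Defensive.
Import Order.TTheory GRing.Theory Num.Theory.
Local Open Scope ring_scope.

(* N-photon, M-mode Fock basis states |k_1,...,k_M>, sum k_i = N. *)
Definition fock (M N : nat) :=
  {k : {ffun 'I_M -> 'I_N.+1} | (\sum_(i < M) (k i : nat) == N)%N}.

Definition occ (M N : nat) (k : fock M N) (i : 'I_M) : nat := val k i.

(* k! := prod_i k_i! *)
Definition fock_fact (M N : nat) (k : fock M N) : nat := (\prod_(i < M) (occ k i)`!)%N.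

(* the photons of Fock state mu: pairs (mode j, copy c < mu_j) *)
Definition photons (M N : nat) (mu : fock M N) := {j : 'I_M & 'I_(occ mu j)}.

Section Optics.
Variable R : realType.
Local Notation C := R[i].

(* <nu| U(g) |mu> for g in U(M), where U(g) a_j^dag U(g)^dag = sum_k g_kj a_k^dag :
   U(g)|mu> = prod_j (sum_k g_kj a_k^dag)^{mu_j}/sqrt(mu_j!) |0>, so the amplitude is
   sqrt(nu!)/sqrt(mu!) * [x^nu] prod_j (sum_k g_kj x_k)^{mu_j}. *)
Definition Uamp (M N : nat) (g : 'M[C]_M) (nu mu : fock M N) : C :=
  sqrtC (fock_fact nu)%:R / sqrtC (fock_fact mu)%:R *
  \sum_(f : {ffun photons mu -> 'I_M} |
          [forall k : 'I_M, #|[pred p | f p == k]| == occ nu k])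
     \prod_(p : photons mu) g (f p) (tag p).

Definition unitary (M : nat) (g : 'M[C]_M) : Prop :=
  g *m (map_mx (fun z : C => z^*) g)^T = 1%:M.

(* density operators on the N-photon, M-mode space *)
Definition density (M N : nat) (rho : fock M N -> fock M N -> C) : Prop :=
  (forall a b, rho b a = (rho a b)^*) /\
  (forall v : fock M N -> C, 0 <= \sum_a \sum_b (v a)^* * rho a b * v b) /\
  \sum_a rho a a = 1.

(* mu (M' modes) is a extended by vacuum in the last M'-M modes *)
Definition is_ext (M M' N : nat) (a : fock M N) (mu : fock M' N) : bool :=
  [forall i : 'I_M', occ mu i == oapp (fun j : 'I_M => occ a j) 0%N (insub (val i))].

(* rho (x) |0><0| *)
Definition vac_ext (M M' N : nat) (rho : fock M N -> fock M N -> C)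
  (mu nu : fock M' N) : C :=
  \sum_(a : fock M N) \sum_(b : fock M N)
     (if is_ext a mu && is_ext b nu then rho a b else 0).

(* p_{nu',g} = <nu'| U(g)^dag (rho (x) |0><0|) U(g) |nu'> *)
Definition prob (M M' N : nat) (rho : fock M N -> fock M N -> C)
  (g : 'M[C]_M') (nu : fock M' N) : C :=
  \sum_(a : fock M' N) \sum_(b : fock M' N)
     (Uamp g a nu)^* * vac_ext rho a b * Uamp g b nu.

(* configurations g_1..g_R allow reconstruction of every N-photon M-mode state *)
Definition allows_reconstruction (M M' N Rn : nat) (g : 'I_Rn -> 'M[C]_M') : Prop :=
  forall rho1 rho2 : fock M N -> fock M N -> C,
    density rho1 -> density rho2 ->
    (forall (j : 'I_Rn) (nu : fock M' N), prob rho1 (g j) nu = prob rho2 (g j) nu) ->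
    rho1 = rho2.

End Optics.

Definition R_NM (N M : nat) : nat := ('C(N + M, N) - 'C(N + M - 2, M))%N.

Definition R_NMM' (N M M' : nat) : int :=
  Num.ceil ((((N + M - 2)`! * (M' - 2)`!)%N%:R / ((N + M' - 2)`! * (M - 2)`!)%N%:R
             * (R_NM N M)%:R) : rat).

(* Main.v *)
Require Import Defs.
From HB Require Import structures.
From mathcomp Require Import all_boot all_order all_algebra all_fingroup.
From mathcomp Require Import reals.
From mathcomp Require Import complex.
From mathcomp Require Import mpoly ring zify.
Import Order.TTheory GRing.Theory Num.Theory.
Local Open Scope ring_scope.

Set Implicit Arguments.
Unset Strict Implicit.
Unset Printing Implicit Defensive.

(* Consider operators X on the N-photon space in the kernel of the photon-loss
   map X |-> sum_k a_k X a_k^dag. This map commutes with conjugation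
   by every U(g), and the diagonal of the image depends only on the diagonal of
   X, so the outcome distribution p of X satisfies
   sum_i (kappa_i + 1) p_{kappa + e_i} = 0 for every (N-1)-photon kappa. Hence p is determined by the outcomes with no photon in mode 0, of
   which there are C(N + M' - 2, N). If R configurations allow reconstruction,
   the R C(N + M' - 2, N) corresponding functionals separate the kernel, whose
   dimension is at least C(N + M - 1, N)^2 - C(N + M - 2, N - 1)^2: a nonzero
   hermitian traceless X invisible to all of them could be added in a small
   amount to the maximally mixed state. *)

(** * Fock states: adding and removing a photon, counting *)

Lemma fockP (M N : nat) (a b : fock M N) : (forall i, occ a i = occ b i) -> a = b.
Proof. by move=> ab; apply/val_inj/ffunP => i; apply/val_inj/ab. Qed.

Lemma sum_occ (M N : nat) (a : fock M N) : (\sum_i occ a i = N)%N.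
Proof. exact/eqP/(valP a). Qed.

Lemma fock_of_proof (M N : nat) (f : 'I_M -> nat) (fN : (\sum_i f i = N)%N) :
  (\sum_i ([ffun i => inord (f i)] : {ffun 'I_M -> 'I_N.+1}) i == N)%N.
Proof.
apply/eqP; rewrite -[RHS]fN; apply: eq_bigr => i _.
by rewrite ffunE inordK // -fN ltnS (bigD1 i) //= leq_addr.
Qed.

Definition fock_of (M N : nat) (f : 'I_M -> nat) (fN : (\sum_i f i = N)%N) : fock M N :=
  exist _ [ffun i => inord (f i)] (fock_of_proof fN).

Lemma occ_fock_of (M N : nat) (f : 'I_M -> nat) (fN : (\sum_i f i = N)%N) i :
  occ (fock_of fN) i = f i.
Proof. by rewrite /occ /= ffunE inordK // -fN ltnS (bigD1 i) //= leq_addr. Qed.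

Lemma create_proof (M N : nat) (k : 'I_M) (a : fock M N) :
  (\sum_i (occ a i + (i == k)) = N.+1)%N.
Proof.
by rewrite big_split /= sum_occ -addn1 (bigD1 k) //= eqxx big1 // => i /negPf ->.
Qed.

Definition create (M N : nat) (k : 'I_M) (a : fock M N) : fock M N.+1 :=
  fock_of (create_proof k a).

Lemma occ_create (M N : nat) (k : 'I_M) (a : fock M N) i :
  occ (create k a) i = (occ a i + (i == k))%N.
Proof. exact: occ_fock_of. Qed.

Lemma create_inj (M N : nat) (k : 'I_M) : injective (@create M N k).
Proof.
move=> a b ab; apply: fockP => i.
by have := congr1 (fun c => occ c i) ab; rewrite !occ_create => /addIn.
Qed.

Lemma create_surj (M N : nat) (k : 'I_M) (b : fock M N.+1) :
  (0 < occ b k)%N -> {a | create k a = b}.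
Proof.
move=> bk.
(* The truncated subtraction is exact because [0 < occ b k]. *)
have sN : (\sum_i (occ b i - (i == k)) = N)%N.
  apply/eqP; rewrite -(eqn_add2r 1).
  rewrite -{1}(_ : (\sum_i (i == k) = 1)%N); last first.
    by rewrite (bigD1 k) //= eqxx big1 // => i /negPf ->.
  rewrite -big_split /= addn1 -{2}(sum_occ b); apply/eqP/eq_bigr => i _.
  by rewrite subnK //; case: eqP => // ->.
exists (fock_of sN); apply: fockP => i; rewrite occ_create occ_fock_of subnK //.
by case: eqP => // ->.
Qed.

Lemma fock_fact_create (M N : nat) (k : 'I_M) (a : fock M N) :
  fock_fact (create k a) = ((occ a k).+1 * fock_fact a)%N.
Proof.
rewrite /fock_fact (bigD1 k) //= [in RHS](bigD1 k) //= occ_create eqxx addn1.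
rewrite factS mulnA; congr (_ * _)%N; apply: eq_bigr => i /negPf ik.
by rewrite occ_create ik addn0.
Qed.

Lemma fock_fact_gt0 (M N : nat) (a : fock M N) : (0 < fock_fact a)%N.
Proof. by rewrite /fock_fact prodn_gt0 // => i; exact: fact_gt0. Qed.

Lemma big_create (V : nmodType) (M N : nat) (k : 'I_M) (F : fock M N.+1 -> V) :
  \sum_(b | (0 < occ b k)%N) F b = \sum_(a : fock M N) F (create k a).
Proof.
rewrite (reindex_omap (@create M N k) (fun b => [pick a | create k a == b])) /=.
  apply: eq_bigl => a; rewrite occ_create eqxx addn1 /=.
  case: pickP => [a' /eqP /create_inj -> | /(_ a)]; first by rewrite eqxx.
  by rewrite eqxx.
move=> b bk; case: (create_surj bk) => a <-.
by case: pickP => [a' /eqP /= -> // | /(_ a)]; rewrite eqxx.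
Qed.

(** Stars and bars: a Fock state is a tuple of [m.+1] naturals with sum [n]. *)
Lemma card_fock (m n : nat) : #|{: fock m.+1 n}| = 'C(m + n, m).
Proof.
pose h (f : {ffun 'I_m.+1 -> 'I_n.+1}) := [tuple f i | i < m.+1].
have h_bij : bijective h.
  exists (fun t => [ffun i => tnth t i]) => [f | t].
    by apply/ffunP => i; rewrite ffunE tnth_mktuple.
  by apply: eq_from_tnth => i; rewrite tnth_mktuple ffunE.
rewrite card_sig -card_ord_partitions -(on_card_preimset (onW_bij _ h_bij)).
rewrite cardsE; apply: eq_card => f.
rewrite -[RHS]/(h f \in [set t : m.+1.-tuple 'I_n.+1 | (\sum_(i <- t) i == n)%N]) !inE.
by rewrite big_tuple; under [in RHS]eq_bigr do rewrite tnth_mktuple.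
Qed.

(** * Transition amplitudes as polynomial coefficients *)

Section Amplitudes.
Variable R : realType.
Local Notation C := R[i].

(** [Uamp] without its square roots, so that adding a photon gives a recursion free of normalization
    factors. *)
Definition amp (M N : nat) (g : 'M[C]_M) (a nu : fock M N) : C :=
  \sum_(f : {ffun photons nu -> 'I_M} |
          [forall k : 'I_M, #|[pred p | f p == k]| == occ a k])
     \prod_(p : photons nu) g (f p) (tag p).

(* The image of the creation operator of mode j, with a_k^dag read as 'X_k. *)
Definition mode_poly (M : nat) (g : 'M[C]_M) (j : 'I_M) : {mpoly C[M]} :=
  \sum_k (g k j)%:MP * 'X_k.

Definition fock_mnm (M N : nat) (a : fock M N) : 'X_{1..M} :=
  [multinom occ a i | i < M].

(** The polynomial in the creation operators that produces sqrt(nu!) U(g)|nu> from the vacuum. *)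
Definition out_poly (M N : nat) (g : 'M[C]_M) (nu : fock M N) : {mpoly C[M]} :=
  \prod_j mode_poly g j ^+ occ nu j.

(** Expanding the product photon by photon, each [f] chooses an output mode per photon and
    contributes the monomial whose exponents are the fibre sizes of [f]. *)
Lemma ampE (M N : nat) (g : 'M[C]_M) (a nu : fock M N) :
  amp g a nu = (out_poly g nu)@_(fock_mnm a).
Proof.
have -> : out_poly g nu = \prod_(p : photons nu) mode_poly g (tag p).
  rewrite -(@sig_big_dep _ _ _ _ (fun j => 'I_(occ nu j)) xpredT (fun _ => xpredT)
             (fun j _ => mode_poly g j)) /=.
  by apply: eq_bigr => j _; rewrite prodr_const card_ord.
rewrite bigA_distr_bigA raddf_sum /= /amp big_mkcond; apply: eq_bigr => f _ /=.
rewrite big_split /= -rmorph_prod mcoeffCM.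
under [X in _ * X@__]eq_bigr do rewrite -['X_(_)]expr1.
rewrite mprodXnE mcoeffX.
rewrite (_ : [forall k, _] = ((\sum_p U_(f p) *+ 1)%MM == fock_mnm a)).
  by case: eqP; rewrite ?mulr1 ?mulr0.
have cntE k : (\sum_p U_(f p) *+ 1)%MM k = #|[pred p | f p == k]|.
  rewrite mnm_sumE -sum1_card [RHS]big_mkcond; apply: eq_bigr => p _ /=.
  by rewrite mulmnE mnm1E muln1 inE; case: eqP.
apply/forallP/eqP => [fa | fa k].
  by apply/mnmP => k; rewrite cntE mnmE; apply/eqP.
by rewrite -cntE fa mnmE.
Qed.

Lemma out_poly_create (M N : nat) (g : 'M[C]_M) (i : 'I_M) (nu : fock M N) :
  out_poly g (create i nu) = out_poly g nu * mode_poly g i.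
Proof.
rewrite /out_poly (bigD1 i) //= [in RHS](bigD1 i) //= occ_create eqxx addn1 exprSr.
rewrite mulrAC; do 2!congr (_ * _).
by apply: eq_bigr => j /negPf ji; rewrite occ_create ji addn0.
Qed.

(** Since [create k] is injective, the sum has at most one term; it is empty when mode [k] of [b]
    holds no photon, so later uses need no case distinction. *)
Lemma mcoeff_mulX (M N : nat) (p : {mpoly C[M]}) (k : 'I_M) (b : fock M N.+1) :
  (p * 'X_k)@_(fock_mnm b) = \sum_(a | create k a == b) p@_(fock_mnm a).
Proof.
have [bk | bk] := posnP (occ b k).
  rewrite big_pred0 => [|a]; last first.
    by apply/eqP => ab; move: bk; rewrite -ab occ_create eqxx addn1.
  rewrite mcoeffM big1 // => -[m1 m2] /= /eqP bE; rewrite mcoeffX.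
  case: eqP => [m2E | _]; last by rewrite mulr0.
  have := congr1 (fun m : 'X_{1..M} => m k) bE.
  by rewrite mnmDE -m2E mnm1E eqxx mnmE bk addn1.
case: (create_surj bk) => a <-.
rewrite (big_pred1 a) => [|c]; last by rewrite (inj_eq (@create_inj _ _ _)).
rewrite -(mcoeffMX p U_(k)); congr (_@__); apply/mnmP => i.
by rewrite mnmDE mnm1E !mnmE occ_create addnC eq_sym.
Qed.

Lemma amp_create (M N : nat) (g : 'M[C]_M) (b : fock M N.+1) (i : 'I_M) (nu : fock M N) :
  amp g b (create i nu) = \sum_k g k i * \sum_(a | create k a == b) amp g a nu.
Proof.
rewrite ampE out_poly_create mulr_sumr raddf_sum /=; apply: eq_bigr => k _.
rewrite mulrCA mcoeffCM mcoeff_mulX; congr (_ * _).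
by apply: eq_bigr => a _; rewrite ampE.
Qed.

End Amplitudes.

(** * Photon loss and its covariance under the interferometer *)

Section Contraction.
Variable R : realType.
Local Notation C := R[i].

(* The photon-loss map X |-> sum_k a_k X a_k^dag, expressed on
   Y a b = sqrt (a! b!) X a b; [normalize] recovers X from Y. *)
Definition contract (M N : nat) (Z : fock M N.+1 -> fock M N.+1 -> C) (a b : fock M N) : C :=
  \sum_k Z (create k a) (create k b).

(** The outcome probability of [normalize Z] multiplied by nu!, as [prob_normalize] makes
    precise. *)
Definition quad (M N : nat) (g : 'M[C]_M) (Z : fock M N -> fock M N -> C) (nu : fock M N) : C :=
  \sum_a \sum_b (amp g a nu)^* * Z a b * amp g b nu.

Lemma sum_fiber_mul (I J : finType) (h : I -> J) (G : I -> C) (F : J -> C) :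
  \sum_b (\sum_(a | h a == b) G a) * F b = \sum_a G a * F (h a).
Proof.
under eq_bigr do rewrite mulr_suml big_mkcond /=.
rewrite exchange_big /=; apply: eq_bigr => a _.
rewrite (bigD1 (h a)) //= eqxx big1 ?addr0 // => b.
by rewrite eq_sym => /negPf ->.
Qed.

(** The rows of [g] are orthonormal, so its transpose preserves the inner product. *)
Lemma unitary_dot (M : nat) (g : 'M[C]_M) (x y : 'I_M -> C) : unitary g ->
  \sum_i (\sum_k g k i * x k)^* * (\sum_k g k i * y k) = \sum_k (x k)^* * y k.
Proof.
move=> gU.
have orth k l : \sum_i g l i * (g k i)^* = (l == k)%:R.
  have := congr1 (fun A : 'M_M => A l k) gU; rewrite !mxE => <-.
  by apply: eq_bigr => i _; rewrite !mxE.
transitivity (\sum_k \sum_l (x k)^* * y l * \sum_i g l i * (g k i)^*).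
  under eq_bigr do rewrite rmorph_sum mulr_suml /=.
  rewrite exchange_big /=; apply: eq_bigr => k _.
  under eq_bigr do rewrite mulr_sumr /=.
  rewrite exchange_big /=; apply: eq_bigr => l _.
  rewrite mulr_sumr; apply: eq_bigr => i _.
  by rewrite rmorphM /= [(g k i)^* * _]mulrC [g l i * y l]mulrC mulrACA [_ * g l i]mulrC.
apply: eq_bigr => k _; rewrite (bigD1 k) //= orth eqxx mulr1 big1 ?addr0 // => l.
by rewrite orth => /negPf ->; rewrite mulr0.
Qed.

(** Photon loss commutes with U(g), read on the diagonal. By [amp_create] the amplitudes at
    [create i nu] are obtained by applying the transpose of [g] to a vector indexed by the mode [k];
    summing over [i] pairs two such vectors, and unitarity removes [g]. *)
Lemma quad_create (M N : nat) (g : 'M[C]_M) (Z : fock M N.+1 -> fock M N.+1 -> C)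
    (nu : fock M N) : unitary g ->
  \sum_i quad g Z (create i nu) = quad g (contract Z) nu.
Proof.
(* [D k b] is the coefficient of the monomial of [b] in [out_poly g nu * 'X_k]. *)
move=> gU; pose D k b := \sum_(a | create k a == b) amp g a nu.
transitivity (\sum_k \sum_a \sum_b (D k a)^* * (D k b * Z a b)).
  rewrite /quad exchange_big [RHS]exchange_big /=; apply: eq_bigr => a _.
  rewrite exchange_big [RHS]exchange_big /=; apply: eq_bigr => b _.
  under [in RHS]eq_bigr do rewrite mulrA.
  rewrite -mulr_suml -(unitary_dot _ _ gU) mulr_suml; apply: eq_bigr => i _.
  by rewrite !amp_create mulrAC.
rewrite /quad /contract.
transitivity (\sum_k \sum_a \sum_b
   (amp g a nu)^* * (amp g b nu * Z (create k a) (create k b))).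
  apply: eq_bigr => k _.
  under eq_bigr do rewrite -mulr_sumr /D sum_fiber_mul rmorph_sum /=.
  by rewrite sum_fiber_mul; apply: eq_bigr => a _; rewrite mulr_sumr.
rewrite exchange_big /=; apply: eq_bigr => a _.
rewrite exchange_big /=; apply: eq_bigr => b _.
rewrite -mulrA [X in _ = _ * X]mulr_suml mulr_sumr; apply: eq_bigr => k _.
by rewrite [amp _ _ _ * _]mulrC.
Qed.

(** * Ancillary modes in vacuum *)

Lemma is_extP (M d N : nat) (a : fock M N) (mu : fock (M + d) N) :
  reflect ((forall i, occ mu (lshift d i) = occ a i) /\ (forall j, occ mu (rshift M j) = 0%N))
          (is_ext a mu).
Proof.
have exl (i : 'I_M) : insub (val (lshift d i)) = Some i.
  by rewrite insubT /= => [|lt]; [exact: ltn_ord | congr Some; apply: val_inj].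
have exr (j : 'I_d) : insub (val (rshift M j)) = None :> option 'I_M.
  by rewrite insubF //= ltnNge leq_addr.
apply: (iffP forallP) => [ext | [el er] i].
  split=> i.
    by move/eqP: (ext (lshift d i)) => ->; rewrite exl.
  by move/eqP: (ext (rshift M i)) => ->; rewrite exr.
by case: (split_ordP i) => j ->; rewrite ?el ?er ?exl ?exr.
Qed.

Lemma fock_fact_ext (M d N : nat) (a : fock M N) (mu : fock (M + d) N) :
  is_ext a mu -> fock_fact mu = fock_fact a.
Proof.
move=> /is_extP[el er]; rewrite /fock_fact big_split_ord /= [X in (_ * X)%N]big1 ?muln1.
  by apply: eq_bigr => i _; rewrite el.
by move=> j _; rewrite er.
Qed.

Lemma is_ext_create_lshift (M d N : nat) (k : 'I_M) (a : fock M N) (mu : fock (M + d) N) :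
  is_ext (create k a) (create (lshift d k) mu) = is_ext a mu.
Proof.
apply/is_extP/is_extP => -[el er]; split=> i; rewrite ?occ_create.
- have := el i; rewrite !occ_create (inj_eq (@lshift_inj _ _)); exact: addIn.
- by have := er i; rewrite occ_create eq_rlshift addn0.
- by rewrite el (inj_eq (@lshift_inj _ _)).
- by rewrite er eq_rlshift.
Qed.

Lemma is_ext_create_rshift (M d N : nat) (k : 'I_d) (a : fock M N.+1) (mu : fock (M + d) N) :
  is_ext a (create (rshift M k) mu) = false.
Proof. by apply/is_extP => -[_ /(_ k)]; rewrite occ_create eqxx addn1. Qed.

Lemma big_is_ext_create (V : nmodType) (M d N : nat) (k : 'I_M) (mu : fock (M + d) N)
    (F : fock M N.+1 -> V) :
  \sum_(a | is_ext a (create (lshift d k) mu)) F a = \sum_(a | is_ext a mu) F (create k a).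
Proof.
under [RHS]eq_bigl do rewrite -(is_ext_create_lshift k).
rewrite big_mkcond [RHS]big_mkcond -(big_create k (fun b => if is_ext b _ then F b else 0)).
rewrite [LHS](bigID (fun b => 0 < occ b k)%N) /= [X in _ + X]big1 ?addr0 // => b bk.
case: is_extP => // -[/(_ k) bE _]; move: bk.
by rewrite -bE occ_create eqxx addn1.
Qed.

Lemma vac_extE (M M' N : nat) (Y : fock M N -> fock M N -> C) (mu nu : fock M' N) :
  vac_ext Y mu nu = \sum_(a | is_ext a mu) \sum_(b | is_ext b nu) Y a b.
Proof.
rewrite /vac_ext [RHS]big_mkcond; apply: eq_bigr => a _.
by case: (is_ext a mu); rewrite /= -?big_mkcond // big1.
Qed.

(** An ancillary mode holds no photon to lose, so only the first [M] modes contribute to the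
    loss. *)
Lemma contract_vac_ext (M M' N : nat) (Y : fock M N.+1 -> fock M N.+1 -> C) (a b : fock M' N) :
  (M <= M')%N -> contract (vac_ext Y) a b = vac_ext (contract Y) a b.
Proof.
move=> /subnKC MM'; move: (M' - M)%N MM' => d MM'; case: _ / MM' in a b *.
rewrite /contract big_split_ord /= [X in _ + X]big1 ?addr0 => [|k _]; last first.
  by rewrite vac_extE big_pred0 // => c; exact: is_ext_create_rshift.
rewrite vac_extE.
under eq_bigr do rewrite vac_extE big_is_ext_create.
rewrite exchange_big /=; apply: eq_bigr => a' _.
under eq_bigr do rewrite big_is_ext_create.
by rewrite exchange_big.
Qed.

(** * Normalization, probabilities, and outcomes with mode 0 empty *)

Definition fock_sqrt (M N : nat) (a : fock M N) : C := sqrtC (fock_fact a)%:R.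

Lemma fock_sqrt_gt0 (M N : nat) (a : fock M N) : 0 < fock_sqrt a.
Proof. by rewrite sqrtC_gt0 ltr0n fock_fact_gt0. Qed.

Lemma conj_fock_sqrt (M N : nat) (a : fock M N) : (fock_sqrt a)^* = fock_sqrt a.
Proof. by rewrite conj_Creal // ger0_real // ltW // fock_sqrt_gt0. Qed.

Definition normalize (M N : nat) (Y : fock M N -> fock M N -> C) (a b : fock M N) : C :=
  Y a b / (fock_sqrt a * fock_sqrt b).

(** Empty modes contribute 0! = 1, so a state and its extension have the same factorial. *)
Lemma vac_ext_normalize (M M' N : nat) (Y : fock M N -> fock M N -> C) (a b : fock M' N) :
  (M <= M')%N -> vac_ext (normalize Y) a b = normalize (vac_ext Y) a b.
Proof.
move=> /subnKC MM'; move: (M' - M)%N MM' => d MM'; case: _ / MM' in a b *.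
rewrite /normalize !vac_extE mulr_suml; apply: eq_bigr => a' aa'.
rewrite mulr_suml; apply: eq_bigr => b' bb'.
by rewrite /fock_sqrt (fock_fact_ext aa') (fock_fact_ext bb').
Qed.

Lemma prob_normalize (M M' N : nat) (Y : fock M N -> fock M N -> C)
    (g : 'M[C]_M') (nu : fock M' N) :
  (M <= M')%N -> prob (normalize Y) g nu = quad g (vac_ext Y) nu / (fock_fact nu)%:R.
Proof.
move=> MM'; rewrite /prob /quad mulr_suml; apply: eq_bigr => a _.
rewrite mulr_suml; apply: eq_bigr => b _.
rewrite vac_ext_normalize // /normalize /Uamp -/(amp g a nu) -/(amp g b nu).
rewrite -!/(fock_sqrt _) !rmorphM fmorphV /= !conj_fock_sqrt.
have -> : (fock_fact nu)%:R = fock_sqrt nu ^+ 2 by rewrite sqrtCK.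
have [a0 b0 n0] : [/\ fock_sqrt a != 0, fock_sqrt b != 0 & fock_sqrt nu != 0].
  by rewrite !gt_eqF ?fock_sqrt_gt0.
move: (fock_sqrt a) (fock_sqrt b) (fock_sqrt nu) a0 b0 n0 => x y z x0 y0 z0.
by field; rewrite x0 y0 z0.
Qed.

(* The relation at k expresses q at k + e_0 through states with fewer photons
   in mode 0. *)
Lemma eq0_of_create_sum (V : zmodType) (m n : nat) (q : fock m.+1 n.+1 -> V) :
  (forall k : fock m.+1 n, \sum_i q (create i k) = 0) ->
  (forall nu, occ nu ord0 = 0%N -> q nu = 0) -> forall nu, q nu = 0.
Proof.
move=> qS q0 nu; move: {2}(occ nu ord0) (erefl (occ nu ord0)) => t.
elim: t nu => [|t IHt] nu nu0; first exact: q0.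
have [|k kE] := @create_surj _ _ ord0 nu; first by rewrite nu0.
have := qS k; rewrite (bigD1 ord0) //= kE big1 ?addr0 // => i i0.
apply: IHt; rewrite occ_create eq_sym (negPf i0) addn0.
by apply/eqP; rewrite -eqSS -nu0 -kE occ_create eqxx addn1.
Qed.

Lemma vac0_proof (m N : nat) (a : fock m N) :
  (\sum_(i < m.+1) oapp (occ a) 0%N (unlift ord0 i) = N)%N.
Proof.
rewrite big_ord_recl unlift_none /= add0n -[RHS](sum_occ a).
by apply: eq_bigr => i _; rewrite liftK.
Qed.

(** The empty mode is put first, unlike in [is_ext]: these are the outcomes on which
    [eq0_of_create_sum] needs vanishing as a hypothesis. *)
Definition vac0 (m N : nat) (a : fock m N) : fock m.+1 N := fock_of (vac0_proof a).

Lemma vac0_surj (m N : nat) (nu : fock m.+1 N) : occ nu ord0 = 0%N -> exists a, vac0 a = nu.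
Proof.
move=> nu0; have sN : (\sum_i occ nu (lift ord0 i) = N)%N.
  by rewrite -[RHS](sum_occ nu) [RHS]big_ord_recl nu0.
exists (fock_of sN); apply: fockP => i; rewrite occ_fock_of.
by case: unliftP => [j|] -> /=; rewrite ?occ_fock_of ?nu0.
Qed.

End Contraction.

(** * Homogeneous linear systems *)

Section LinearForms.
Variables (F : fieldType) (I : finType).

(** The coefficients are kept as data, ready to be the columns of a matrix. *)
Definition linear_form (L : (I -> F) -> F) :=
  {k : I -> F | forall x, L x = \sum_i k i * x i}.

Lemma linear_form_proj (i : I) : linear_form (fun x => x i).
Proof.
exists (fun j => (j == i)%:R) => x; rewrite (bigD1 i) //= eqxx mul1r big1 ?addr0 // => j.
by move=> /negPf ->; rewrite mul0r.
Qed.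

Lemma linear_form_sum (J : finType) (P : pred J) (L : J -> (I -> F) -> F) :
  (forall j, linear_form (L j)) -> linear_form (fun x => \sum_(j | P j) L j x).
Proof.
move=> Llin; exists (fun i => \sum_(j | P j) sval (Llin j) i) => x.
under [RHS]eq_bigr do rewrite mulr_suml.
by rewrite exchange_big /=; apply: eq_bigr => j _; exact: (svalP (Llin j)).
Qed.

Lemma linear_form_mul (c d : F) (L : (I -> F) -> F) :
  linear_form L -> linear_form (fun x => c * L x * d).
Proof.
move=> [k kE]; exists (fun i => c * k i * d) => x; rewrite kE mulr_sumr mulr_suml.
by apply: eq_bigr => i _; rewrite !mulrA [RHS]mulrAC.
Qed.

(** With one row per unknown and one column per equation, the matrix has rank at most [#|J|], hence
    a nonzero left kernel vector. *)
Lemma ex_common_zero (J : finType) (L : J -> (I -> F) -> F) :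
  (forall j, linear_form (L j)) -> (#|J| < #|I|)%N ->
  exists2 x : I -> F, exists i, x i != 0 & forall j, L j x = 0.
Proof.
move=> Llin ltJI.
pose A : 'M[F]_(#|I|, #|J|) := \matrix_(i, j) sval (Llin (enum_val j)) (enum_val i).
have /rowV0Pn[v /sub_kermxP vA v0] : kermx A != 0.
  rewrite kermx_eq0 -row_leq_rank -ltnNge.
  by apply: leq_ltn_trans ltJI; exact: rank_leq_col.
exists (fun i => v 0 (enum_rank i)).
  have /rV0Pn[i vi] := v0.
  by exists (enum_val i); rewrite enum_valK.
move=> j; have := congr1 (fun B : 'rV_#|J| => B 0 (enum_rank j)) vA; rewrite !mxE => <-.
rewrite (svalP (Llin j)) (reindex _ (onW_bij _ (@enum_val_bij I))) /=.
by apply: eq_bigr => i _; rewrite enum_valK !mxE enum_rankK mulrC.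
Qed.

End LinearForms.

(** * Perturbing the maximally mixed state *)

Section Perturbation.
Variable R : realType.
Local Notation C := R[i].

(** Photon loss multiplies the trace by the photon number, as sum_k a_k^dag a_k is the number
    operator. *)
Lemma trace_normalize (M N : nat) (Y : fock M N.+1 -> fock M N.+1 -> C) :
  (forall a, contract Y a a = 0) -> \sum_a normalize Y a a = 0.
Proof.
move=> Y0; have N0 : N.+1%:R != 0 :> C by rewrite pnatr_eq0.
apply: (mulfI N0); rewrite mulr0.
transitivity (\sum_a contract Y a a / (fock_fact a)%:R); last first.
  by rewrite big1 // => a _; rewrite Y0 mul0r.
transitivity (\sum_b \sum_k (occ b k)%:R * normalize Y b b).
  rewrite mulr_sumr; apply: eq_bigr => b _.
  by rewrite -mulr_suml -natr_sum sum_occ.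
under [RHS]eq_bigr do rewrite mulr_suml.
rewrite exchange_big [RHS]exchange_big /=; apply: eq_bigr => k _.
rewrite (bigID (fun b => 0 < occ b k)%N) /= [X in _ + X]big1 ?addr0; last first.
  by move=> b; rewrite -eqn0Ngt => /eqP ->; rewrite mul0r.
rewrite big_create; apply: eq_bigr => a _.
rewrite /normalize -expr2 sqrtCK fock_fact_create natrM occ_create eqxx addn1.
by rewrite mulrCA invfM mulVKf // pnatr_eq0.
Qed.

(** A crude bound suffices: each product |v_a| |v_b| is at most the squared norm of [v]. *)
Lemma norm_form_le (I : finType) (H : I -> I -> C) (v : I -> C) :
  `|\sum_a \sum_b (v a)^* * H a b * v b| <=
  (\sum_a \sum_b `|H a b|) * \sum_a `|v a| ^+ 2.
Proof.
have v2_le a : `|v a| ^+ 2 <= \sum_a `|v a| ^+ 2.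
  by rewrite (bigD1 a) //= lerDl sumr_ge0 // => b _; rewrite exprn_ge0.
set S := \sum_a `|v a| ^+ 2 in v2_le *.
have S0 : 0 <= S by rewrite sumr_ge0 // => a _; rewrite exprn_ge0.
rewrite mulr_suml; apply: le_trans (ler_norm_sum _ _ _) _; apply: ler_sum => a _.
rewrite mulr_suml; apply: le_trans (ler_norm_sum _ _ _) _; apply: ler_sum => b _.
rewrite !normrM norm_conjC [`|v a| * _]mulrC -mulrA ler_wpM2l //.
rewrite -(@ler_pXn2r _ 2) ?nnegrE ?mulr_ge0 // exprMn [S ^+ 2]expr2.
by rewrite ler_pM ?exprn_ge0.
Qed.

Lemma density_perturb (M N : nat) (H : fock M N -> fock M N -> C) (e : C) :
  (0 < #|{: fock M N}|)%N ->
  (forall a b, H b a = (H a b)^*) -> \sum_a H a a = 0 ->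
  0 <= e -> e * (\sum_a \sum_b `|H a b|) <= #|{: fock M N}|%:R^-1 ->
  density (fun a b => (a == b)%:R / #|{: fock M N}|%:R + e * H a b).
Proof.
set A := #|_|; move=> A0 Hh Ht e0 eH.
have AV_conj : (A%:R^-1 : C)^* = A%:R^-1 by rewrite fmorphV /= conjC_nat.
split; [|split] => [a b | v |].
- by rewrite rmorphD !rmorphM /= conjC_nat AV_conj (conj_Creal (ger0_real e0)) -Hh eq_sym.
- pose Q := \sum_a \sum_b (v a)^* * H a b * v b.
  pose S := \sum_a `|v a| ^+ 2.
  have -> : \sum_a \sum_b (v a)^* * ((a == b)%:R / A%:R + e * H a b) * v b = A%:R^-1 * S + e * Q.
    rewrite !mulr_sumr -big_split /=; apply: eq_bigr => a _.
    under eq_bigr do rewrite mulrDr mulrDl.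
    rewrite big_split /=; congr (_ + _).
      rewrite (bigD1 a) //= eqxx mul1r big1 ?addr0 => [|b]; last first.
        by rewrite eq_sym => /negPf ->; rewrite mul0r mulr0 mul0r.
      by rewrite normCKC mulrAC mulrC.
    by rewrite mulr_sumr; apply: eq_bigr => b _; rewrite mulrCA !mulrA.
  have Q_real : Q \is Num.real.
    apply/CrealP; rewrite /Q rmorph_sum /= exchange_big; apply: eq_bigr => a _ /=.
    rewrite rmorph_sum /=.
    by apply: eq_bigr => b _; rewrite !rmorphM /= conjCK -Hh mulrC [v a * _]mulrC mulrA.
  have S0 : 0 <= S by rewrite sumr_ge0 // => a _; rewrite exprn_ge0.
  (* [Q] being real, it is at least -K S with K the sum of the [|H a b|]; the form is then at least
     (1/A - e K) S. *)
  have := ler_wpM2l e0 (real_lerNnormlW Q_real (norm_form_le H v)).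
  rewrite -/S mulrN mulrA => eQ.
  apply: le_trans (lerD (lexx _) eQ).
  by rewrite -mulrBl mulr_ge0 // subr_ge0.
- rewrite big_split /= -mulr_sumr Ht mulr0 addr0.
  under eq_bigr do rewrite eqxx mul1r.
  by rewrite sumr_const -[LHS]mulr_natl mulfV // pnatr_eq0 -lt0n.
Qed.

Lemma reconstruction_hermitian0 (M M' N Rn : nat) (g : 'I_Rn -> 'M[C]_M')
    (H : fock M N -> fock M N -> C) :
  allows_reconstruction M N g -> (0 < #|{: fock M N}|)%N ->
  (forall a b, H b a = (H a b)^*) -> \sum_a H a a = 0 ->
  (forall j nu, prob H (g j) nu = 0) -> forall a b, H a b = 0.
Proof.
move=> grec A0 Hh Ht Hp a0 b0.
set A := #|_| in A0.
pose K := \sum_a \sum_b `|H a b|.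
have K0 : 0 <= K by rewrite sumr_ge0 // => a _; rewrite sumr_ge0.
(* The summand 1 keeps [e] well defined and positive even if [K = 0], and still gives e K <= 1/A. *)
pose e : C := (A%:R * (1 + K))^-1.
have A_gt0 : 0 < A%:R :> C by rewrite ltr0n.
have K1_gt0 : 0 < 1 + K by rewrite ltr_pwDl.
have e0 : 0 < e by rewrite invr_gt0 mulr_gt0.
have eK : e * K <= A%:R^-1.
  rewrite /e invfM -mulrA ler_piMr ?invr_ge0 ?ler0n //.
  by rewrite ler_pdivrMl // mulr1 lerDr.
pose E (a b : fock M N) : C := (a == b)%:R / A%:R.
(* The maximally mixed state is written as the perturbation of size 0, so that [probE] treats both
   states. *)
have d0 : density (fun a b => E a b + 0 * H a b).
  by apply: density_perturb; rewrite ?mul0r ?invr_ge0 ?ler0n.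
have de := density_perturb A0 Hh Ht (ltW e0) eK.
have probE t j nu : prob (fun a b => E a b + t * H a b) (g j) nu =
    prob E (g j) nu + t * prob H (g j) nu.
  rewrite /prob !mulr_sumr -big_split /=; apply: eq_bigr => a _.
  rewrite mulr_sumr -big_split /=; apply: eq_bigr => b _.
  have -> : vac_ext (fun a b => E a b + t * H a b) a b =
      vac_ext E a b + t * vac_ext H a b.
    rewrite !vac_extE mulr_sumr -big_split /=; apply: eq_bigr => c _.
    by rewrite mulr_sumr -big_split.
  by ring.
have probs j nu : prob (fun a b => E a b + 0 * H a b) (g j) nu =
    prob (fun a b => E a b + e * H a b) (g j) nu by rewrite !probE Hp !mulr0.
have /(congr1 (fun f => f a0 b0)) := grec _ _ d0 de probs.
by rewrite mul0r => /addrI /esym /eqP; rewrite mulf_eq0 gt_eqF //= => /eqP.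
Qed.

End Perturbation.

(** * Hermitian parts and the dimension count *)

Section Counting.
Variable R : realType.
Local Notation C := R[i].

(** Twice the Hermitian part of [c * Y]. Linear algebra over C yields an arbitrary complex [Y],
    whereas a perturbation must be Hermitian; [c = 1] and [c = 'i] together recover [Y]. *)
Definition herm_part (T : Type) (c : C) (Y : T -> T -> C) (a b : T) : C :=
  c * Y a b + (c * Y b a)^*.

Lemma herm_part_conj (T : Type) (c : C) (Y : T -> T -> C) (a b : T) :
  herm_part c Y b a = (herm_part c Y a b)^*.
Proof. by rewrite /herm_part rmorphD /= conjCK addrC. Qed.

Lemma herm_part_eq0 (T : Type) (Y : T -> T -> C) (a b : T) :
  herm_part 1 Y a b = 0 -> herm_part 'i Y a b = 0 -> Y a b = 0.
Proof.
rewrite /herm_part !mul1r rmorphM /= conjCi mulNr -mulrBr => h1 /eqP.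
rewrite mulf_eq0 (negPf (neq0Ci _)) /= => /eqP h2.
by move/eqP: h1; rewrite -(subr0_eq h2) -mulr2n mulrn_eq0 /= => /eqP.
Qed.

Lemma contract_herm_part (M N : nat) (c : C) (Y : fock M N.+1 -> fock M N.+1 -> C) a b :
  contract (herm_part c Y) a b = herm_part c (contract Y) a b.
Proof. by rewrite /contract /herm_part big_split /= -mulr_sumr -rmorph_sum -mulr_sumr. Qed.

Lemma vac_ext_herm_part (M M' N : nat) (c : C) (Y : fock M N -> fock M N -> C)
    (mu nu : fock M' N) :
  vac_ext (herm_part c Y) mu nu = herm_part c (vac_ext Y) mu nu.
Proof.
rewrite /herm_part !vac_extE [X in (c * X)^*]exchange_big !mulr_sumr rmorph_sum.
rewrite -big_split /=; apply: eq_bigr => a _.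
by rewrite !mulr_sumr rmorph_sum -big_split.
Qed.

Lemma quad_herm_part (M N : nat) (g : 'M[C]_M) (c : C) (Z : fock M N -> fock M N -> C) nu :
  quad g (herm_part c Z) nu = c * quad g Z nu + (c * quad g Z nu)^*.
Proof.
rewrite /quad; move: (amp g) => u.
rewrite [X in (c * X)^*]exchange_big !mulr_sumr rmorph_sum -big_split /=.
apply: eq_bigr => a _; rewrite !mulr_sumr rmorph_sum -big_split /=; apply: eq_bigr => b _.
by rewrite /herm_part !rmorphM /= conjCK; ring.
Qed.

(* The left-hand side counts the entries of an operator; the right-hand side
   counts the equations making it lie in the kernel of [contract] and be
   invisible on the outcomes with mode 0 empty, hence invisible. *)
Lemma reconstruction_count (p m n Rn : nat) (g : 'I_Rn -> 'M[C]_m.+1) :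
  (p <= m)%N -> (forall j, unitary (g j)) ->
  allows_reconstruction p.+1 n.+1 g ->
  (#|{: fock p.+1 n.+1}| ^ 2 <= #|{: fock p.+1 n}| ^ 2 + Rn * #|{: fock m n.+1}|)%N.
Proof.
move=> lepm gU grec; rewrite leqNgt; apply/negP => lt_card.
pose I : finType := (fock p.+1 n.+1 * fock p.+1 n.+1)%type.
pose J : finType := (fock p.+1 n * fock p.+1 n + 'I_Rn * fock m n.+1)%type.
pose L (j : J) (x : I -> C) : C :=
  let Y (a b : fock p.+1 n.+1) := x (a, b) in
  match j with
  | inl (a, b) => contract Y a b
  | inr (j, nu) => quad (g j) (vac_ext Y) (vac0 nu)
  end.
have Llin j : linear_form (L j).
  case: j => [[a b] | [j nu]] /=.
    by apply: linear_form_sum => k; exact: linear_form_proj.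
  apply: linear_form_sum => a; apply: linear_form_sum => b.
  apply: (@linear_form_mul _ _ _ _ (fun x => vac_ext (fun a b => x (a, b)) a b)).
  apply: linear_form_sum => c; apply: linear_form_sum => d.
  case: (_ && _); first exact: linear_form_proj.
  by exists (fun=> 0) => x; rewrite big1 // => i; rewrite mul0r.
(* The negated bound says [#|J| < #|I|]: fewer equations than matrix entries. *)
have [|x [[a0 b0] x0] Lx] := ex_common_zero Llin.
  by rewrite card_sum !card_prod card_ord.
pose Y (a b : fock p.+1 n.+1) : C := x (a, b).
have Y_contract a b : contract Y a b = 0 by exact: (Lx (inl (a, b))).
(* The loss of [Y] vanishes, so [quad_create] gives the relations among outcomes; those with mode 0
   empty vanish by the choice of [x]. *)
have Y_quad j nu : quad (g j) (vac_ext Y) nu = 0.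
  apply: eq0_of_create_sum nu => [k | nu nu0].
    rewrite quad_create // /quad big1 // => a _; rewrite big1 // => b _.
    rewrite contract_vac_ext // vac_extE big1 ?mulr0 ?mul0r // => c _.
    by rewrite big1.
  by have [a <-] := vac0_surj nu0; exact: (Lx (inr (j, a))).
have H0 c : forall a b, herm_part c Y a b = 0.
  have c0 : forall a b, contract (herm_part c Y) a b = 0.
    by move=> a b; rewrite contract_herm_part /herm_part !Y_contract mulr0 conjC0 addr0.
  have N0 : forall a b, normalize (herm_part c Y) a b = 0.
    apply: reconstruction_hermitian0 grec _ _ _ _.
    - by rewrite card_fock bin_gt0 leq_addr.
    - move=> a b; rewrite /normalize herm_part_conj [in RHS]rmorphM fmorphV rmorphM /=.
      by rewrite !conj_fock_sqrt [fock_sqrt R b * _]mulrC.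
    - exact: trace_normalize.
    - move=> j nu; rewrite prob_normalize //.
      rewrite (_ : quad _ _ _ = quad (g j) (herm_part c (vac_ext Y)) nu).
        by rewrite quad_herm_part Y_quad mulr0 conjC0 addr0 mul0r.
      by apply: eq_bigr => a _; apply: eq_bigr => b _; rewrite vac_ext_herm_part.
  move=> a b; have s0 : fock_sqrt R a * fock_sqrt R b != 0.
    by rewrite mulf_neq0 // gt_eqF // fock_sqrt_gt0.
  by apply: (mulIf (invr_neq0 s0)); rewrite mul0r; exact: N0.
by move/eqP: x0; apply; exact: (@herm_part_eq0 _ Y).
Qed.

End Counting.

(** * Binomial arithmetic *)

(** Pascal's rule twice. The summands are the dimensions of the N-photon and (N-1)-photon spaces on
    M modes. *)
Lemma R_NM_sum (n p : nat) :
  R_NM n.+1 p.+2 = ('C(p.+1 + n.+1, p.+1) + 'C(p.+1 + n, p.+1))%N.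
Proof.
rewrite /R_NM -bin_sub ?leq_addr // addKn.
have -> : (n.+1 + p.+2 = (p + n).+3)%N by lia.
rewrite !subSS subn0 !(addnS, addSn) (binS (p + n).+2 p.+1) (binS (p + n).+1 p.+1).
by rewrite addnAC -addnA addKn addnC.
Qed.

(** The difference of squares factors: the sum of the two dimensions is [R_NM] and their difference
    is ['C(p + n.+1, p)] by Pascal's rule. *)
Lemma binomial_count (n p m Rn : nat) :
  ('C(p.+1 + n.+1, p.+1) ^ 2 <= 'C(p.+1 + n, p.+1) ^ 2 + Rn * 'C(m + n.+1, m))%N ->
  ('C(p + n.+1, p) * R_NM n.+1 p.+2 <= Rn * 'C(m + n.+1, m))%N.
Proof.
rewrite R_NM_sum addSn binS addnS -addSn => le_sq.
rewrite -(leq_add2l ('C(p.+1 + n, p.+1) ^ 2)); apply: leq_trans le_sq.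
by rewrite -!mulnn; nia.
Qed.

Lemma fact_binE (n p : nat) : (n + p.+2 - 2)`! = ('C(p + n, p) * (p`! * n`!))%N.
Proof.
by rewrite !addnS !subSS subn0 addnC -(bin_fact (leq_addr n p)) addKn.
Qed.

(** By [fact_binE] the factorial quotient is ['C(p + n.+1, p)] over ['C(m + n.+1, m)], and a ceiling
    is at most an integer when its argument is. *)
Lemma R_NMM'_le (n p m Rn : nat) :
  ('C(p + n.+1, p) * R_NM n.+1 p.+2 <= Rn * 'C(m + n.+1, m))%N ->
  R_NMM' n.+1 p.+2 m.+2 <= Rn%:Z.
Proof.
move=> le_count; rewrite /R_NMM' ceil_le_int pmulrn mulrAC ler_pdivrMr; last first.
  by rewrite ltr0n muln_gt0 !fact_gt0.
rewrite -!natrM ler_nat !fact_binE !subSS !subn0.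
have := leq_mul le_count (leqnn (p`! * n.+1`! * m`!)%N).
by congr (_ <= _)%N; ring.
Qed.

Theorem theorem2 (R : realType) (N M : nat) (hN : (1 <= N)%N) (hM : (2 <= M)%N) :
  (forall (Rn : nat) (g : 'I_Rn -> 'M[R[i]]_M),
     (forall j, unitary (g j)) ->
     @allows_reconstruction R M M N Rn g -> (R_NM N M <= Rn)%N) /\
  (forall (M' Rn : nat) (g : 'I_Rn -> 'M[R[i]]_M'),
     (M < M')%N ->
     (forall j, unitary (g j)) ->
     @allows_reconstruction R M M' N Rn g -> R_NMM' N M M' <= Rn%:Z).
Proof.
case: N hN => // n _; case: M hM => [|[|p]] // _.
split=> [Rn g gU grec | [|[|m]] // Rn g ltM gU grec].
  have := reconstruction_count (leqnn _) gU grec; rewrite !card_fock.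
  (* For M' = M the binomials on both sides coincide and cancel. *)
  by move=> /binomial_count; rewrite mulnC leq_pmul2r // bin_gt0 leq_addr.
have lepm : (p.+1 <= m.+1)%N by exact: ltnW.
have := reconstruction_count lepm gU grec; rewrite !card_fock.
by move=> /binomial_count /R_NMM'_le.
Qed.
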